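(* Let $n\geq 3$, let $\pi$ be a triangulation of the regular $n$-gon $\mathcal{P}_n$, and let $U(\pi)=(u_{ij})_{1\leq i,j\leq n}$ be the symmetric matrix of cluster variables and stable variables associated to $\mathcal{P}_n$ (with $u_{ii}=0$), regarded as elements of the field $\mathbb{F}$ of rational functions attached to $\pi$. Then $$\det(U(\pi))=-(-2)^{n-2}\,u_{12}u_{23}\cdots u_{n-1,n}u_{n1}.$$
   Context: $\mathcal{P}_n$ is a regular $n$-sided polygon with vertices $1,2,\ldots,n$ numbered clockwise around the boundary (vertices taken modulo $n$). A triangulation $\pi$ is a maximal set of pairwise non-crossing diagonals. Given $\pi$, let $\mathbb{F}$ be the field of rational functions over $\mathbb{C}$ in independent variables $u_{ij}=u_{ji}$, one for each pair $\{i,j\}$ of end-points of a diagonal in $\pi$ or of a boundary edge of $\mathcal{P}_n$. Elements $u_{ij}=u_{ji}\in\mathbb{F}$ for $i,j$ the end-points of an arbitrary diagonal of $\mathcal{P}_n$ are defined inductively: if $i,j,k,l$ are vertices of $\mathcal{P}_n$ arranged clockwise around the boundary and $u_{ij},u_{jk},u_{kl},u_{li},u_{ik}$ are defined but $u_{jl}$ is not, define $u_{jl}$ by the exchange relation $$u_{ij}u_{kl}+u_{jk}u_{il}=u_{ik}u_{jl}.$$ These elements are known to be well-defined, and the exchange relation holds for every choice of $i,j,k,l$ arranged clockwise around the boundary. Set $u_{ii}=0$ for all $i$. The $\mathbb{C}$-subalgebra of $\mathbb{F}$ generated by all $u_{ij}$ is a cluster algebra of type $A_{n-3}$; the $u_{ij}$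 for diagonals are its cluster variables and the $u_{ij}$ for boundary edges its stable variables. *)

(* Defs.v *)
From mathcomp Require Import all_boot all_order all_algebra.
From mathcomp Require Import fraction.
From mathcomp Require Import complex mpoly.
From mathcomp Require Import classical_sets reals.

Set Implicit Arguments.
Unset Strict Implicit.
Unset Printing Implicit Defensive.

Import GRing.Theory.
Local Open Scope ring_scope.

(* The vertices 1, ..., n of the polygon are the elements 0, ..., n-1 of 'I_n,
   numbered clockwise; ordS is the cyclic successor.  Edges and diagonals are
   identified with their sets of end-points. *)

Definition clockwise n (i j k l : 'I_n) : bool :=
  [|| (i < j < k)%N && (k < l)%N, (j < k < l)%N && (l < i)%N,
      (k < l < i)%N && (i < j)%N | (l < i < j)%N && (j < k)%N].

Definition boundary n : {set {set 'I_n}} := [set [set i; ordS i] | i : 'I_n].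

Definition diagonals n : {set {set 'I_n}} :=
  [set d : {set 'I_n} | #|d| == 2%N] :\: boundary n.

Definition crossing n (d e : {set 'I_n}) : bool :=
  [exists i, exists j, exists k, exists l,
    [&& clockwise i j k l, d == [set i; k] & e == [set j; l]]].

Definition noncrossing n (D : {set {set 'I_n}}) : bool :=
  (D \subset diagonals n) && [forall d in D, forall e in D, ~~ crossing d e].

Definition triangulation n (pi : {set {set 'I_n}}) : bool :=
  maxset (@noncrossing n) pi.

Section ClusterVariables.

(* R[i] is the field of complex numbers. *)
Variables (R : realType) (n : nat) (pi : {set {set 'I_n}}).

Definition seed : {set {set 'I_n}} := pi :|: boundary n.

Definition ratfun : fieldType := {fraction ({mpoly R[i][#|seed|]})}.

Definition seed_var (e : {set 'I_n}) (he : e \in seed) : ratfun :=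
  tofrac ('X_(enum_rank_in he e) : {mpoly R[i][#|seed|]}).

(* [defines e x]: the value x is assigned to u_e by finitely many uses of the
   exchange relation, starting from the independent variables.  There is no
   side condition that u_jl be not yet defined, as the value obtained does not
   depend on the sequence of exchanges. *)
Inductive defines : {set 'I_n} -> ratfun -> Prop :=
| defines_seed (e : {set 'I_n}) (he : e \in seed) : defines e (seed_var he)
| defines_exchange (i j k l : 'I_n) (uij ujk ukl uli uik ujl : ratfun) :
    clockwise i j k l ->
    defines [set i; j] uij -> defines [set j; k] ujk ->
    defines [set k; l] ukl -> defines [set l; i] uli ->
    defines [set i; k] uik ->
    uij * ukl + ujk * uli = uik * ujl ->
    defines [set j; l] ujl.

(* The default value 0 of xget is immaterial: for a triangulation, every pair
   of distinct vertices is assigned a (unique) value. *)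
Definition cluster_var (i j : 'I_n) : ratfun :=
  if i == j then 0 else xget 0 (defines [set i; j]).

Definition cluster_matrix : 'M[ratfun]_n := \matrix_(i, j) cluster_var i j.

End ClusterVariables.

(* Main.v *)
(* Every pair [ik] of the seed with i + 1 < k is the base of a
   triangle [ijk] of the triangulation, so the polygon can be filled in by
   induction on the length of the interval [i..k].  This shows that every u_ab
   is reached by exchanges, and it also yields points p_a of the plane F^2 with
   u_ab = det (p_a, p_b) for a < b on the seed.  The Pluecker relations are the
   exchange relations, so this equality propagates to all a < b, provided that
   no division by zero occurs; it does not, since every value obtained by
   exchanges is a quotient of polynomials that are positive at (1, ..., 1).

   For the determinant D_(n+1) on the vertices 0, ..., n, the exchange relation
   applied to 0, j, n-1, n shows that a combination of rows 0, n-1, n vanishes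
   outside the last column, hence
   u_(0,n-1) D_(n+1) = - 2 u_(n-1,n) u_(0,n) D_n. *)

Require Import Defs.
From mathcomp Require Import all_boot all_order all_algebra.
From mathcomp Require Import fraction complex mpoly reals.
From mathcomp Require classical_sets.
From mathcomp Require Import zify ring.

Set Implicit Arguments.
Unset Strict Implicit.
Unset Printing Implicit Defensive.

Import Order.TTheory GRing.Theory Num.Theory.
Local Open Scope ring_scope.

(** * Induction on intervals cut at the apex of a triangle *)

Section Intervals.

Variables (m : nat) (s : rel nat).
Hypothesis apex : forall i k, (i.+1 < k <= m)%N -> s i k ->
  exists j, [/\ (i < j < k)%N, s i j & s j k].

(** Cut at the apex [j]; induction settles the pairs on either side. A pair across [j] takes two
    exchanges: [i], [j], [b], [k] with known diagonal [jk] gives [ib], then [i], [a], [j], [b] with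
    known diagonal [ij] gives [ab]. *)
Lemma exchange_fill (D : nat -> nat -> Prop) :
  (forall a b, (a < b <= m)%N -> s a b -> D a b) ->
  (forall i j k l, (i < j)%N -> (j < k)%N -> (k < l <= m)%N ->
    D i j -> D j k -> D k l -> D i l -> (D i k -> D j l) /\ (D j l -> D i k)) ->
  forall i k, (i < k <= m)%N -> s i k ->
  forall a b, (i <= a)%N -> (a < b)%N -> (b <= k)%N -> D a b.
Proof.
move=> Ds Dx i k; have [d] := ubnP (k - i); elim: d i k => // d IH i k ltd ikm sik.
have [ki|ik] := leqP k i.+1.
  move=> a b ia ab bk; have -> : a = i by lia.
  have -> : b = k by lia.
  exact: Ds.
have [|j [/andP[ij jk] sij sjk]] := @apex i k _ sik; first lia.
have Dl := IH i j ltac:(lia) ltac:(lia) sij.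
have Dr := IH j k ltac:(lia) ltac:(lia) sjk.
have Dik : D i k by apply: Ds.
have Di b : (j < b)%N -> (b <= k)%N -> D i b.
  move=> jb bk; have [->//|nbk] := eqVneq b k.
  have [|||||||_] := Dx i j b k => //; try lia.
  - by apply: Dl; lia.
  - by apply: Dr; lia.
  - by apply: Dr; lia.
  by apply; apply: Dr; lia.
move=> a b ia ab bk.
have [bj|jb] := leqP b j; first by apply: Dl; lia.
have [ja|aj] := leqP j a; first by apply: Dr; lia.
have [->|nai] := eqVneq a i; first by apply: Di.
have [|||||||+ _] := Dx i a j b => //; try lia.
- by apply: Dl; lia.
- by apply: Dl; lia.
- by apply: Dr; lia.
- by apply: Di.
by apply; apply: Dl; lia.
Qed.

Definition det2 (F : fieldType) (P Q : F * F) : F := P.1 * Q.2 - P.2 * Q.1.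

Hypothesis uncrossed : forall a b c d, (a < c)%N -> (c < b)%N -> (b < d <= m)%N ->
  s a b -> s c d -> False.

(** The points at both ends of the base are prescribed, so that the realizations over [ij] and [jk]
    can be glued at a common point. *)
Lemma plane_realization (F : fieldType) (w : nat -> nat -> F) :
  (forall a b, (a < b <= m)%N -> s a b -> w a b != 0) ->
  forall i k, (i < k <= m)%N -> s i k ->
  forall P Q, det2 P Q = w i k ->
  exists p : nat -> F * F, [/\ p i = P, p k = Q &
    forall a b, (i <= a)%N -> (a < b)%N -> (b <= k)%N -> s a b ->
      det2 (p a) (p b) = w a b].
Proof.
move=> w0 i k; have [d] := ubnP (k - i); elim: d i k => // d IH i k ltd ikm sik P Q dPQ.
have [ki|ik] := leqP k i.+1.
  exists (fun a => if a == i then P else Q); split; rewrite ?eqxx //.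
    by case: eqP => // ?; lia.
  move=> a b ia ab bk _; have -> : a = i by lia.
  have -> : b = k by lia.
  by rewrite eqxx; case: eqP => // ?; lia.
have [|j [/andP[ij jk] sij sjk]] := @apex i k _ sik; first lia.
have wik := w0 i k ikm sik.
(* Cramer's rule: [T] is the solution of det (P, T) = w_ij and det (T, Q) = w_jk. *)
pose T : F * F := (w j k / w i k * P.1 + w i j / w i k * Q.1,
                   w j k / w i k * P.2 + w i j / w i k * Q.2).
have dPT : det2 P T = w i j by move: wik; rewrite /det2 /= -dPQ /det2 => ?; field.
have dTQ : det2 T Q = w j k by move: wik; rewrite /det2 /= -dPQ /det2 => ?; field.
have [p [pi pj pE]] := IH i j ltac:(lia) ltac:(lia) sij _ _ dPT.
have [q [qj qk qE]] := IH j k ltac:(lia) ltac:(lia) sjk _ _ dTQ.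
exists (fun a => if (a <= j)%N then p a else q a); split.
- by rewrite ltnW.
- by rewrite leqNgt jk.
move=> a b ia ab bk sab; have [aj|ja] := leqP a j; have [bj|jb] := leqP b j.
- exact: pE.
- have [ja|naj] := eqVneq a j; first by rewrite ja pj -qj qE -?ja //; lia.
  (* A seed pair with [a] < [j] < [b] must be the base [ik]: otherwise it crosses [ij] or [jk]. *)
  have [ai|nai] := eqVneq a i; last first.
    by case: (@uncrossed i j a b) => //; lia.
  have [bk'|nbk] := eqVneq b k; first by rewrite ai bk' pi qk.
  by case: (@uncrossed a b j k) => //; lia.
- by lia.
- by apply: qE => //; lia.
Qed.

End Intervals.

(** * Crossings and triangulations in terms of the order of the vertices *)

Section Polygon.

Variable n : nat.
Implicit Types (a b c d i j k l : 'I_n) (pi : {set {set 'I_n}}).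

Lemma set2_eq (T : finType) (a b c d : T) : [set a; b] = [set c; d] ->
  (a = c /\ b = d) \/ (a = d /\ b = c).
Proof.
move=> e.
have := set21 a b; rewrite e !inE; have := set22 a b; rewrite e !inE.
have := set21 c d; rewrite -e !inE; have := set22 c d; rewrite -e !inE.
by do 4![case/orP => /eqP ?]; subst; tauto.
Qed.

Lemma crossing_lt a b c d : (a < b)%N -> (c < d)%N ->
  crossing [set a; b] [set c; d] =
  ((a < c)%N && (c < b)%N && (b < d)%N) || ((c < a)%N && (a < d)%N && (d < b)%N).
Proof.
move=> ab cd; apply/idP/idP.
  case/existsP=> i /existsP[j /existsP[k /existsP[l]]].
  case/and3P=> + /eqP/set2_eq ik /eqP/set2_eq jl.
  by case: ik => -[? ?]; case: jl => -[? ?]; subst; rewrite /clockwise; lia.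
case/orP => h; apply/existsP.
  exists a; apply/existsP; exists c; apply/existsP; exists b; apply/existsP; exists d.
  by rewrite !eqxx !andbT /clockwise; lia.
exists a; apply/existsP; exists d; apply/existsP; exists b; apply/existsP; exists c.
by rewrite (setUC [set c]) !eqxx !andbT /clockwise; lia.
Qed.

Lemma val_ordS i : (ordS i : nat) = if i.+1 == n then 0%N else i.+1.
Proof.
rewrite /=; case: eqP => [->|ne]; first by rewrite modnn.
by rewrite modn_small //; have := ltn_ord i; lia.
Qed.

Lemma boundary_lt a b : (a < b)%N ->
  ([set a; b] \in boundary n) = (b == a.+1 :> nat) || ((a == 0%N :> nat) && (b.+1 == n)).
Proof.
move=> ab; apply/imsetP/idP.
  move=> [i _ /set2_eq e]; have := val_ordS i; have := ltn_ord i; have := ltn_ord b.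
  by case: e => -[? ?]; subst; case: eqP; lia.
case/orP => [/eqP h|/andP[/eqP h1 /eqP h2]].
  exists a => //; congr [set a; _]; apply/ord_inj; rewrite val_ordS /=.
  by have := ltn_ord b; case: eqP; lia.
by exists b => //; rewrite setUC; congr [set b; _]; apply/ord_inj; rewrite val_ordS h2 eqxx.
Qed.

Lemma card2_lt (e : {set 'I_n}) : #|e| = 2%N ->
  exists a b : 'I_n, (a < b)%N /\ e = [set a; b].
Proof.
move/eqP/cards2P => [a [b [ab ->]]].
have : a != b :> nat by [].
rewrite neq_ltn => /orP[h|h]; first by exists a, b.
by exists b, a; rewrite setUC.
Qed.

Variable pi : {set {set 'I_n}}.
Hypothesis pi_tri : triangulation pi.
Hypothesis n_ge3 : (3 <= n)%N.

Lemma triangulation_diagonals : pi \subset diagonals n.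
Proof. by have /andP[] := maxsetp pi_tri. Qed.

Lemma triangulation_uncrossed (d e : {set 'I_n}) : d \in pi -> e \in pi -> ~~ crossing d e.
Proof. by have /andP[_ /forall_inP h] := maxsetp pi_tri => /h/forall_inP; apply. Qed.

Lemma mem_seed_lt a b : [set a; b] \in seed pi -> a != b.
Proof.
rewrite inE; case/orP => [/(subsetP triangulation_diagonals)|].
  by rewrite /diagonals !inE cards2; case: (a != b); rewrite ?andbF.
case/imsetP => i _ e; have : ordS i != i :> nat.
  by rewrite val_ordS; case: ifP; lia.
by apply: contra_neq => ab; case/set2_eq: e => -[<- <-]; rewrite ab.
Qed.

(** Two members of [pi] do not cross by definition, and a boundary edge has no vertex strictly on
    one of its sides. *)
Lemma seed_uncrossed a b c d : (a < c)%N -> (c < b)%N -> (b < d)%N ->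
  [set a; b] \in seed pi -> [set c; d] \in seed pi -> False.
Proof.
move=> ac cb bd; rewrite !inE !boundary_lt; [|lia..].
have := ltn_ord d => dn; case/orP => [ab|]; last lia.
case/orP => [cd|]; last lia.
by have := triangulation_uncrossed ab cd; rewrite crossing_lt; [|lia..]; rewrite ac cb bd.
Qed.

(** Unless [ab] is a boundary edge, adding it to [pi] gives a non-crossing set again, which equals
    [pi] by maximality. *)
Lemma triangulation_maximal a b : (a < b)%N ->
  (forall c d, (c < d)%N -> [set c; d] \in pi -> ~~ crossing [set a; b] [set c; d]) ->
  [set a; b] \in seed pi.
Proof.
move=> ab nc; rewrite inE; case: (boolP (_ \in boundary n)) => [|nb]; first by rewrite orbT.
rewrite orbF; have <- : [set a; b] |: pi = pi; last by rewrite setU11.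
apply: (maxsetsup pi_tri); last exact: subsetUr.
have sub := subsetP triangulation_diagonals.
have lt2 e : e \in pi -> exists c d, (c < d)%N /\ e = [set c; d].
  by move/sub; rewrite /diagonals !inE => /andP[_ /eqP/card2_lt].
apply/andP; split.
  rewrite subUset triangulation_diagonals andbT sub1set /diagonals !inE nb cards2.
  by have -> : a != b by apply: contraTneq ab => ->; rewrite ltnn.
apply/forall_inP => d; rewrite in_setU1 => dpi; apply/forall_inP => e; rewrite in_setU1 => epi.
case/orP: dpi epi => [/eqP-> | dpi] /orP[/eqP-> | epi].
- by rewrite crossing_lt //; lia.
- by have [x [y [xy e2]]] := lt2 _ epi; rewrite e2 in epi *; apply: nc.
- have [x [y [xy e2]]] := lt2 _ dpi; rewrite e2 in dpi *.
  by have := nc _ _ xy dpi; rewrite !crossing_lt //; lia.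
- exact: triangulation_uncrossed.
Qed.

(* The apex is the last vertex [j] before [k] joined to [i]: a diagonal of [pi]
   crossing [jk] crosses neither [ij] nor [ik], so it issues from [i] and ends
   strictly between [j] and [k]. *)
Lemma seed_apex i k : (i.+1 < k)%N -> [set i; k] \in seed pi ->
  exists j, [/\ (i < j < k)%N, [set i; j] \in seed pi & [set j; k] \in seed pi].
Proof.
move=> ik sik.
have kn := ltn_ord k.
pose j0 : 'I_n := ordS i.
have j0E : j0 = i.+1 :> nat by rewrite val_ordS; case: eqP; lia.
pose P j := (i < j < k)%N && ([set i; j] \in seed pi).
(* The boundary edge from [i] to its successor ensures that a last such [j] exists. *)
have Pj0 : P j0.
  by rewrite /P j0E leqnn ik inE boundary_lt ?j0E // eqxx orbT.
case: (arg_maxnP (fun j : 'I_n => j : nat) Pj0) => j /andP[ijk sij] jmax.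
exists j; split => //; have {ijk}/andP[ij jk] := ijk.
apply: triangulation_maximal => // c d cd scd; rewrite crossing_lt //.
have {}scd : [set c; d] \in seed pi by rewrite inE scd.
apply/negP => /orP[/andP[/andP[jc ck] kd]|/andP[/andP[cj jd] dk]].
  by apply: (@seed_uncrossed i k c d) => //; lia.
have [ci|ic|/val_inj ci] := ltngtP c i.
- by apply: (@seed_uncrossed c d i k) => //; lia.
- by apply: (@seed_uncrossed i j c d) => //; lia.
have /jmax : P d by rewrite /P -ci scd andbT; lia.
by rewrite /=; lia.
Qed.

End Polygon.

(** * Determinants of symmetric matrices satisfying the Ptolemy relations *)

Section PtolemyDeterminant.

Variables (F : fieldType) (u : nat -> nat -> F).
Hypothesis uC : forall a b, u a b = u b a.
Hypothesis u0 : forall a, u a a = 0.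
Hypothesis ptolemy : forall i j k l, (i <= j)%N -> (j <= k)%N -> (k <= l)%N ->
  u i j * u k l + u j k * u i l = u i k * u j l.

Let umx n : 'M[F]_n := \matrix_(i, j) u i j.

Lemma det_ptolemy_rec n :
  u 0%N n * \det (umx n.+2) = - 2 * u n n.+1 * u 0%N n.+1 * \det (umx n.+1).
Proof.
case: n => [|n].
  by rewrite u0 mul0r det_mx11 mxE u0 mulr0.
(* The last row of [A] is u_(0,n+1) times row n+2, minus u_(0,n+2) times row n+1, minus u_(n+1,n+2)
   times row 0. *)
pose A : 'M[F]_n.+3 := \matrix_(i, j)
  if i == ord_max then
    if j == ord_max then - 2 * u n.+1 n.+2 * u 0%N n.+2 else 0
  else u i j.
have Alast : \det A = - 2 * u n.+1 n.+2 * u 0%N n.+2 * \det (umx n.+2).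
  rewrite (expand_det_row _ ord_max) big_ord_recr /= big1 ?add0r => [|i _].
    rewrite mxE !eqxx /cofactor /= -signr_odd oddD addbb mul1r; congr (_ * \det _).
    apply/matrixP => i j; rewrite !mxE.
    by rewrite eq_sym (negPf (neq_lift _ _)) !lift_max.
  rewrite mxE eqxx; case: eqP => [/(congr1 val)/= e|]; last by rewrite mul0r.
  by have := ltn_ord i; lia.
rewrite -Alast.
pose p : 'I_n.+3 := inord n.+1.
have pE : p = n.+1 :> nat by rewrite inordK.
(* Row [x] is repeated as the last row. Multilinearity splits off one such matrix at a time, with
   [C] as the intermediate stage. *)
pose B (x : 'I_n.+3) : 'M[F]_n.+3 := \matrix_(i, j) if i == ord_max then u x j else u i j.
have B0 x : x != ord_max -> \det (B x) = 0.
  move=> xm; apply: (determinant_alternate xm) => j.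
  by rewrite !mxE eqxx (negPf xm).
have row'B x : row' ord_max (B x) = row' ord_max (umx n.+3).
  by apply/matrixP => i j; rewrite !mxE eq_sym (negPf (neq_lift _ _)).
pose C : 'M[F]_n.+3 := \matrix_(i, j)
  if i == ord_max then u 0%N n.+1 * u n.+2 j - u 0%N n.+2 * u n.+1 j else u i j.
have e1 : \det C = u 0%N n.+1 * \det (umx n.+3) + - u 0%N n.+2 * \det (B p).
  apply: (determinant_multilinear (i0 := ord_max)).
  - apply/rowP => j; rewrite !mxE eqxx /= pE; ring.
  - by apply/matrixP => i j; rewrite !mxE eq_sym (negPf (neq_lift _ _)).
  - by apply/matrixP => i j; rewrite !mxE eq_sym (negPf (neq_lift _ _)).
have e2 : \det A = 1 * \det C + - u n.+1 n.+2 * \det (B ord0).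
  apply: (determinant_multilinear (i0 := ord_max)).
  - apply/rowP => j; rewrite !mxE eqxx /=.
    case: eqP => [->|/eqP jm] /=.
      by rewrite u0; ring.
    have jn : (j <= n.+1)%N.
      by have := ltn_ord j; have : j != n.+2 :> nat by []; lia.
    (* The weak inequalities in [ptolemy] include the columns [j] = 0 and [j] = n+1. *)
    have := @ptolemy 0%N j n.+1 n.+2 isT jn (leqnSn _).
    rewrite (uC n.+2 j) (uC n.+1 j) => e.
    have -> : u 0%N n.+1 * u j n.+2 = u 0%N j * u n.+1 n.+2 + u j n.+1 * u 0%N n.+2 by rewrite e.
    by ring.
  - by apply/matrixP => i j; rewrite !mxE eq_sym (negPf (neq_lift _ _)).
  - by apply/matrixP => i j; rewrite !mxE eq_sym (negPf (neq_lift _ _)).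
rewrite e2 e1 !B0 ?mulr0 ?addr0 ?mul1r //.
by apply/eqP => /(congr1 val) /=; rewrite pE; lia.
Qed.

(** The induction starts at - u_01^2. In the step, the closing edge of the smaller polygon is a
    factor of its determinant and cancels the left-hand factor of the recursion. *)
Lemma det_ptolemy n : (forall a b, (a < b <= n)%N -> u a b != 0) ->
  \det (umx n.+2) = - (- 2) ^+ n * (\prod_(i < n.+1) u i i.+1) * u 0%N n.+1.
Proof.
elim: n => [|n IH] uN.
  rewrite (expand_det_row _ ord0) !big_ord_recl big_ord0 /cofactor !det_mx11 !mxE /=.
  by rewrite !u0 /bump /= !addn0 big_ord0 (uC 1%N 0%N); ring.
have un0 : u 0%N n.+1 != 0 by apply: uN; rewrite leqnn.
apply: (mulfI un0); rewrite det_ptolemy_rec IH => [|a b ab]; last by apply: uN; lia.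
by rewrite [in RHS]big_ord_recr /= exprS; ring.
Qed.

End PtolemyDeterminant.

(** * Rational functions positive at (1, ..., 1) *)

Section Positivity.

Variables (R : realType) (k : nat).
Let ones : 'I_k -> R[i] := fun=> 1.

(** Excludes 0 and is stable under sums, products and inverses. In [R[i]], 0 < z means that z is
    real and positive. *)
Definition positive_at_ones (x : {fraction {mpoly R[i][k]}}) : Prop :=
  exists f g : {mpoly R[i][k]},
    [/\ x = tofrac f / tofrac g, 0 < f.@[ones] & 0 < g.@[ones]].

Lemma pos_neq0 (f : {mpoly R[i][k]}) : 0 < f.@[ones] -> tofrac f != 0.
Proof. by rewrite tofrac_eq0; apply: contraTneq => ->; rewrite meval0 ltxx. Qed.

Lemma positive_neq0 x : positive_at_ones x -> x != 0.
Proof.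
move=> [f [g [-> f0 g0]]].
have {}f0 := pos_neq0 f0.
have {}g0 := pos_neq0 g0.
by apply: mulf_neq0; [exact: f0 | rewrite invr_eq0; exact: g0].
Qed.

Lemma positiveX i : positive_at_ones (tofrac 'X_i).
Proof.
by exists 'X_i, 1; rewrite mevalXU meval1 /ones ltr01 tofrac1 divr1.
Qed.

Lemma positiveD x y : positive_at_ones x -> positive_at_ones y -> positive_at_ones (x + y).
Proof.
move=> [f [g [-> f0 g0]]] [f' [g' [-> f0' g0']]].
exists (f * g' + f' * g), (g * g'); rewrite mevalD !mevalM addr_gt0 ?mulr_gt0 //; split=> //.
by rewrite tofracD !tofracM addf_div ?pos_neq0.
Qed.

Lemma positiveM x y : positive_at_ones x -> positive_at_ones y -> positive_at_ones (x * y).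
Proof.
move=> [f [g [-> f0 g0]]] [f' [g' [-> f0' g0']]].
by exists (f * f'), (g * g'); rewrite !mevalM !mulr_gt0 // !tofracM mulf_div.
Qed.

Lemma positiveV x : positive_at_ones x -> positive_at_ones x^-1.
Proof. by move=> [f [g [-> f0 g0]]]; exists g, f; rewrite invf_div. Qed.

End Positivity.

Lemma det2_axes (F : fieldType) (c : F) : det2 (1, 0) (0, c) = c.
Proof. by rewrite /det2 /= mul1r mul0r subr0. Qed.

(** * Points of the plane and their Pluecker relations *)

Section PlanarPoints.

Variables (F : fieldType) (p : nat -> F * F).

(** Sorting the indices makes the antisymmetric [det2] symmetric, as the cluster variables are. *)
Definition pdet (a b : nat) : F :=
  if (a <= b)%N then det2 (p a) (p b) else det2 (p b) (p a).

Lemma pdetC a b : pdet a b = pdet b a.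
Proof. by rewrite /pdet; case: ltngtP => // ->. Qed.

Lemma pdet0 a : pdet a a = 0.
Proof. by rewrite /pdet leqnn /det2; ring. Qed.

Lemma pdet_ptolemy i j k l : (i <= j)%N -> (j <= k)%N -> (k <= l)%N ->
  pdet i j * pdet k l + pdet j k * pdet i l = pdet i k * pdet j l.
Proof.
move=> ij jk kl; have ik := leq_trans ij jk; have jl := leq_trans jk kl.
have il := leq_trans ij jl.
by rewrite /pdet ij jk kl ik jl il /det2; ring.
Qed.

(** A rotation by one place swaps the two products of opposite sides and the two diagonals, so all
    four cases reduce to the sorted one. *)
Lemma pdet_clockwise n (i j k l : 'I_n) : clockwise i j k l ->
  pdet i j * pdet k l + pdet j k * pdet l i = pdet i k * pdet j l.
Proof.
case/or4P => /andP[/andP[/ltnW h1 /ltnW h2] /ltnW h3].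
- by rewrite (pdetC l) pdet_ptolemy.
- rewrite addrC (pdetC i j) (pdetC i k) (mulrC (pdet j i)) (mulrC (pdet k i)).
  exact: pdet_ptolemy.
- rewrite (mulrC (pdet i j)) (mulrC (pdet j k)) (pdetC j k) (pdetC i k) (pdetC j l).
  exact: pdet_ptolemy.
- rewrite addrC (mulrC (pdet j k)) (pdetC k l) (mulrC (pdet i k)) (pdetC j l).
  exact: pdet_ptolemy.
Qed.

End PlanarPoints.

(** * Positivity and uniqueness of the values reached by exchanges *)

Section ClusterVariables.

Variables (R : realType) (n : nat) (pi : {set {set 'I_n}}).

Lemma defines_positive e x : @defines R n pi e x -> positive_at_ones x.
Proof.
elim=> {e x} [e he|i j k l uij ujk ukl uli uik ujl _ _ pij _ pjk _ pkl _ pli _ pik e].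
  exact: positiveX.
have <- : uik^-1 * (uij * ukl + ujk * uli) = ujl.
  by rewrite e; apply: mulKf; apply: positive_neq0.
by apply: positiveM; [exact: positiveV | apply: positiveD; exact: positiveM].
Qed.

Definition defined (i j : 'I_n) : Prop := exists x, @defines R n pi [set i; j] x.

Lemma definedC i j : defined i j -> defined j i.
Proof. by rewrite /defined setUC. Qed.

Lemma defined_exchange i j k l : clockwise i j k l ->
  defined i j -> defined j k -> defined k l -> defined l i -> defined i k -> defined j l.
Proof.
move=> c [uij dij] [ujk djk] [ukl dkl] [uli dli] [uik dik].
exists (uik^-1 * (uij * ukl + ujk * uli)).
apply: (defines_exchange c dij djk dkl dli dik).
by rewrite mulVKf //; apply: positive_neq0; apply: defines_positive dik.
Qed.

Hypothesis n_ge3 : (3 <= n)%N.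
Hypothesis pi_tri : triangulation pi.

(** The points do not depend on the sequence of exchanges. Along any such sequence u_ik is nonzero,
    so the Pluecker relation forces the next value. *)
Lemma defines_unique (p : nat -> ratfun R pi * ratfun R pi) :
  (forall (i j : 'I_n) (h : [set i; j] \in seed pi), (i < j)%N ->
    det2 (p i) (p j) = seed_var R h) ->
  forall e x, defines e x -> forall i j : 'I_n, e = [set i; j] -> x = pdet p i j.
Proof.
move=> pE e x; elim=> {e x}.
  move=> e he i j eij; subst e.
  have := mem_seed_lt pi_tri n_ge3 he; rewrite -(inj_eq val_inj) /= neq_ltn.
  case/orP => h; first by rewrite /pdet ltnW // pE.
  rewrite pdetC /pdet (ltnW h); move: he; rewrite setUC => he.
  by rewrite pE.
move=> i j k l uij ujk ukl uli uik ujl c _ IHij _ IHjk _ IHkl _ IHli dik IHik e.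
have uik0 : uik != 0 by apply: positive_neq0; apply: defines_positive dik.
have ujlE : ujl = pdet p j l.
  apply: (mulfI uik0); rewrite -e (IHij _ _ erefl) (IHjk _ _ erefl) (IHkl _ _ erefl).
  by rewrite (IHli _ _ erefl) (IHik _ _ erefl) pdet_clockwise.
move=> a b /set2_eq[[<- <-]|[<- <-]]; first exact: ujlE.
by rewrite pdetC; exact: ujlE.
Qed.

End ClusterVariables.

(** * Cluster variables as determinants of plane points *)

Section Coordinates.

Variables (R : realType) (m : nat) (pi : {set {set 'I_m.+1}}).
Hypothesis m_ge2 : (3 <= m.+1)%N.
Hypothesis pi_tri : triangulation pi.

Let s : rel nat := fun a b => [set inord a; inord b] \in seed pi.

Lemma inord_apex i k : (i.+1 < k <= m)%N -> s i k ->
  exists j, [/\ (i < j < k)%N, s i j & s j k].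
Proof.
move=> /andP[ik km] sik.
have [|j] := seed_apex pi_tri m_ge2 _ sik; first by rewrite !inordK; lia.
rewrite !inordK; [|lia..] => -[ijk sij sjk].
by exists j; rewrite /s inord_val.
Qed.

Lemma inord_uncrossed a b c d : (a < c)%N -> (c < b)%N -> (b < d <= m)%N ->
  s a b -> s c d -> False.
Proof.
by move=> ac cb bd; apply: (seed_uncrossed pi_tri); rewrite ?inordK; lia.
Qed.

(** This edge is the base of the interval of all vertices, to which both inductions on intervals are
    applied. *)
Lemma inord_boundary_edge : s 0 m.
Proof.
rewrite /s inE boundary_lt ?inordK ?ltnS //; last by lia.
by rewrite !eqxx !orbT.
Qed.

Lemma all_defined (i j : 'I_m.+1) : i != j -> defined R pi i j.
Proof.
wlog ij : i j / (i < j)%N.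
  move=> h ij; have := ij; rewrite -(inj_eq val_inj) neq_ltn => /orP[/h|/h]; first exact.
  by rewrite eq_sym => /(_ ij)/definedC.
move=> _; rewrite -(inord_val i) -(inord_val j).
apply: (exchange_fill (m := m) (s := s) (D := fun a b => defined R pi (inord a) (inord b))
   inord_apex _ _ (i := 0) (k := m)) => //; last 3 first.
- by rewrite leqnn andbT; lia.
- exact: inord_boundary_edge.
- by rewrite -ltnS.
- by move=> a b _ sab; exists (seed_var R sab); exact: defines_seed.
move=> a b c d ab bc cd dab dbc dcd dad.
(* The exchange rule yields one diagonal from the other; the rotated quadrilateral gives the
   converse. *)
have cw : clockwise (inord a) (inord b : 'I_m.+1) (inord c) (inord d).
  by rewrite /clockwise !inordK; lia.
have cw' : clockwise (inord b) (inord c : 'I_m.+1) (inord d) (inord a).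
  by rewrite /clockwise !inordK; lia.
split=> dd; first by apply: (defined_exchange cw) => //; apply: definedC.
by apply/definedC; apply: (defined_exchange cw') => //; apply: definedC.
Qed.

Lemma cluster_var_coordinates : exists p : nat -> ratfun R pi * ratfun R pi,
  forall i j : 'I_m.+1, cluster_var R pi i j = pdet p i j.
Proof.
(* A total function extending the seed variables, with a default index off the seed. *)
pose w a b : ratfun R pi :=
  tofrac 'X_(enum_rank_in inord_boundary_edge [set inord a; inord b : 'I_m.+1]).
have wE (i j : 'I_m.+1) (h : [set i; j] \in seed pi) : w i j = seed_var R h.
  rewrite /w !inord_val /seed_var.
  by congr (tofrac 'X_ _); apply: enum_val_inj; rewrite !enum_rankK_in.
have w0 a b : (a < b <= m)%N -> s a b -> w a b != 0.
  by move=> _ _; apply/positive_neq0/positiveX.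
have [||p [_ _ pE]] := plane_realization inord_apex inord_uncrossed w0
  _ inord_boundary_edge (P := (1, 0)) (Q := (0, w 0%N m)).
- by rewrite leqnn andbT; lia.
- exact: det2_axes.
exists p => i j; rewrite /cluster_var; case: eqVneq => [->|ij]; first by rewrite pdet0.
have [x dx] := all_defined ij.
(* A value is assigned to the pair, so [xget] returns an assigned value and not its default 0. *)
have := classical_sets.xgetPex 0 (ex_intro _ x dx).
move/(defines_unique m_ge2 pi_tri); apply => // a b h ab.
by rewrite pE ?wE // ?/s ?inord_val // -ltnS.
Qed.

Lemma cluster_var_neq0 (i j : 'I_m.+1) : i != j -> cluster_var R pi i j != 0.
Proof.
move=> ij; rewrite /cluster_var (negPf ij); have [x dx] := all_defined ij.
by apply: positive_neq0; apply: defines_positive (classical_sets.xgetPex 0 (ex_intro _ x dx)).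
Qed.

End Coordinates.

Theorem theorem1p3 (R : realType) (n : nat) (n_ge3 : (3 <= n)%N)
    (pi : {set {set 'I_n}}) (pi_tri : triangulation pi) :
  \det (cluster_matrix R pi) =
    - (- 2) ^+ (n - 2) * \prod_(i < n) cluster_var R pi i (ordS i).
Proof.
case: n n_ge3 pi pi_tri => [//|[//|n]] n_ge3 pi pi_tri.
have [p pE] := cluster_var_coordinates R n_ge3 pi_tri.
have -> : cluster_matrix R pi = \matrix_(i, j) pdet p i j.
  by apply/matrixP => i j; rewrite !mxE pE.
rewrite det_ptolemy; first last.
- move=> a b ab; have := @cluster_var_neq0 R _ pi n_ge3 pi_tri (inord a) (inord b).
  rewrite pE !inordK; [|lia..]; apply.
  by rewrite -(inj_eq val_inj) /= !inordK; lia.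
- exact: pdet_ptolemy.
- exact: pdet0.
- exact: pdetC.
rewrite !subSS subn0 -mulrA; congr (_ * _).
(* At the last vertex [ordS] returns to 0: this factor of the product is the closing edge. *)
have uE (i : 'I_n.+2) :
    cluster_var R pi i (ordS i) = pdet p i (if i.+1 == n.+2 then 0%N else i.+1).
  by rewrite pE val_ordS.
rewrite (eq_bigr _ (fun i _ => uE i)) [RHS]big_ord_recr /=; congr (_ * _).
  by apply: eq_bigr => i _; rewrite ifF //=; have := ltn_ord i; lia.
by rewrite ifT; [exact: pdetC | exact: eqxx].
Qed.
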